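(* Let $(E,\|\cdot\|)$ be a real normed space and let $R>0$. For every $C\subseteq E$, the set $C^{\rho_R\rho_R}:=(C^{\rho_R})^{\rho_R}$ is the $R$-strongly convex hull of $C$.
   Context: For $c\in E$ and $R>0$, $B(c,R):=\{x\in E:\|x-c\|\le R\}$. A set $C\subseteq E$ is strongly convex with respect to $R>0$ if it is an intersection of a (possibly empty) collection of closed balls of radius $R$; the intersection of the empty collection is $E$. The $R$-strongly convex hull of $C\subseteq E$ is the intersection of all the strongly convex sets with respect to $R$ that contain $C$. The $\rho_R$-polar of $C\subseteq E$ is $C^{\rho_R}:=\{y\in E:\|x-y\|\le R\ \ \forall x\in C\}$. *)

(* Defs.v *)
From mathcomp Require Import all_boot all_order all_algebra.
From mathcomp Require Import all_classical all_reals all_analysis.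
Set Implicit Arguments.
Unset Strict Implicit.
Unset Printing Implicit Defensive.
Import Order.TTheory GRing.Theory Num.Def Num.Theory.
Import numFieldNormedType.Exports.
Local Open Scope classical_set_scope.
Local Open Scope ring_scope.

Section StrongConvexity.
Context {K : realType} {E : normedModType K}.
Implicit Types (R : K) (C : set E).

(* F may be empty; the intersection is then setT, so that E itself is strongly
   convex. The ball closed_ball_ normr c R is [set x | `|c - x| <= R]. *)
Definition strongly_convex R C : Prop :=
  exists F : set (set E),
    (forall B, F B -> exists c : E, B = closed_ball_ normr c R) /\
    C = \bigcap_(B in F) B.

(* smallest P C is, by definition, the intersection of all the sets that
   satisfy P and contain C. *)
Definition strongly_convex_hull R C : set E := smallest (strongly_convex R) C.

Definition polar R C : set E := [set y | forall x, C x -> `|x - y| <= R].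

End StrongConvexity.

(* Main.v *)
Require Import Defs.
From mathcomp Require Import all_boot all_order all_algebra.
From mathcomp Require Import all_classical all_reals all_analysis.
Import Order.TTheory GRing.Theory Num.Theory.
Import numFieldNormedType.Exports.
Local Open Scope classical_set_scope.
Local Open Scope ring_scope.

(** A ball [B(c, R)] contains [C] exactly when its centre [c] lies in the polar
    of [C]; hence the bipolar is the intersection of all the [R]-balls
    containing [C]. *)

(** The bipolar is itself a polar, hence strongly convex, and it contains [C]. It is the least such
    set because every [R]-ball containing [C] also contains the bipolar ([bipolar_min]). *)

Lemma polar_strongly_convex (K : realType) (E : normedModType K) (R : K)
  (C : set E) : strongly_convex R (polar R C).
Proof.
(* By symmetry of the distance, these balls centred at points of [C] cut out the polar. *)
exists [set closed_ball_ Num.norm c R | c in C]; split.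
  by move=> B [c _ <-]; exists c.
by rewrite bigcap_image; apply/seteqP; split.
Qed.

Lemma sub_bipolar (K : realType) (E : normedModType K) (R : K) (C : set E) :
  C `<=` polar R (polar R C).
Proof. by move=> x Cx y Cy; rewrite distrC; exact: Cy. Qed.

Lemma bipolar_min (K : realType) (E : normedModType K) (R : K) (C D : set E) :
  strongly_convex R D -> C `<=` D -> polar R (polar R C) `<=` D.
Proof.
move=> [F [ballF ->]] CD y Cy B FB; have [c Bc] := ballF B FB.
(* As [C] lies in [D], hence in [B], the centre [c] is in the polar of [C], so [y] is within [R] of
   [c]. *)
rewrite Bc; apply: Cy => x Cx.
by have := CD x Cx B FB; rewrite Bc /closed_ball_ /= distrC.
Qed.

Theorem corollary11 (K : realType) (E : normedModType K) (R : K) (hR : 0 < R)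
  (C : set E) :
  polar R (polar R C) = strongly_convex_hull R C.
Proof.
apply/seteqP; split; last first.
  by apply: smallest_sub; [exact: polar_strongly_convex | exact: sub_bipolar].
by move=> y Cy D [scD CD]; exact: (bipolar_min _ _ _ _ _ scD CD).
Qed.
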